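(* Let $P$ be a set of sum-indecomposable (non-empty) permutations and let $n\ge0$. Then the staircase encoding $\mathrm{SE}$ is a bijection between $\mathrm{Av}^{(n)}(2413,3142,1\oplus P)$ and $\mathrm{WI}(\mathcal{D}(B_n),\mathrm{Av}^{+}(2413,3142,P))$.
   Context: A permutation of size $n$ is a word containing each of $1,\dots,n$ exactly once. $\sigma$ contains $\pi$ if some subsequence of $\sigma$ has the same relative order as $\pi$; otherwise $\sigma$ avoids $\pi$. $\mathrm{Av}(P)$ is the set of permutations avoiding every element of $P$, $\mathrm{Av}^{+}(P)$ its non-empty elements. For $\alpha$ of size $a$, $\beta$ of size $b$: $\alpha\oplus\beta=\alpha_1\cdots\alpha_a(\beta_1+a)\cdots(\beta_b+a)$. A permutation is sum-indecomposable if it cannot be written as $\alpha\oplus\beta$ with $\alpha,\beta$ non-empty. $1\oplus P=\{1\oplus\pi:\pi\in P\}$. The empty permutation is not in $P$. A left-to-right minimum of $\sigma$ is an entry $\sigma_i$ with $\sigma_j>\sigma_i$ for all $j<i$; $\mathrm{Av}^{(n)}(Q)$ is the set of permutations in $\mathrm{Av}(Q)$ with exactly $n$ left-to-right minima. The staircase grid is $B_n=\{(i,j):1\le i\le j\le n\}$ (row $i$, column $j$, row 1 on top). If $\sigma$ has left-to-right minima at positions $p_1<\dots<p_n$ with values $v_1>\dots>v_n$, each non-minimum entry $\sigma_k$ lies in cell $(i,j)$ where $j$ is the largest index with $p_j<k$ and $i$ the smallest index with $v_i<\sigma_k$. The staircase encoding $\mathrm{SE}(\sigma)$ is the filling of $B_n$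 putting in each cell the standardization of the entries of $\sigma$ in that cell (empty permutation if none). The down-core $\mathcal{D}(B_n)$ is the graph on $B_n$ with an edge between $(i,j)$ and $(k,\ell)$ whenever $i<k$, $j<\ell$ and the rectangle $\{i,\dots,k\}\times\{j,\dots,\ell\}$ is a subset of $B_n$. For a graph $G$ on $B_n$ and a set $S$ of non-empty permutations, $\mathrm{WI}(G,S)$ is the set of fillings of $B_n$ whose non-empty cells form an independent set of $G$ and all contain elements of $S$. ''SE is a bijection between $X$ and $Y$'' means SE restricted to $X$ is injective with image exactly $Y$. *)

(* Defs.v *)
From mathcomp Require Import all_boot.
From mathcomp Require Import boolp classical_sets functions.

Set Implicit Arguments.
Unset Strict Implicit.
Unset Printing Implicit Defensive.

Local Open Scope classical_set_scope.

Definition is_perm (s : seq nat) : bool := perm_eq s (iota 1 (size s)).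

Definition same_order (s t : seq nat) : Prop :=
  size s = size t /\
  forall i j, i < size s -> j < size s ->
    (nth 0 s i < nth 0 s j) = (nth 0 t i < nth 0 t j).

Definition contains (s p : seq nat) : Prop :=
  exists2 t, subseq t s & same_order t p.

Definition Av (Q : set (seq nat)) : set (seq nat) :=
  [set s | is_perm s /\ forall p, Q p -> ~ contains s p].

Definition Avp (Q : set (seq nat)) : set (seq nat) :=
  [set s | Av Q s /\ s <> [::]].

Definition osum (a b : seq nat) : seq nat := a ++ [seq x + size a | x <- b].

Definition sum_indecomposable (s : seq nat) : Prop :=
  ~ exists a b, [/\ is_perm a, is_perm b, a <> [::], b <> [::] & s = osum a b].

(* Positions of a word, and indices of rows and columns, are counted from 0. *)
Definition is_lrmin (s : seq nat) (k : nat) : bool :=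
  all (fun x => nth 0 s k < x) (take k s).

Definition lrmins (s : seq nat) : seq nat :=
  [seq k <- iota 0 (size s) | is_lrmin s k].

Definition lrmin_pos (s : seq nat) (j : nat) : nat := nth 0 (lrmins s) j.

Definition lrmin_val (s : seq nat) (j : nat) : nat := nth 0 s (lrmin_pos s j).

Definition Avn (n : nat) (Q : set (seq nat)) : set (seq nat) :=
  [set s | Av Q s /\ size (lrmins s) = n].

Definition in_staircase (n : nat) (c : 'I_n * 'I_n) : bool := c.1 <= c.2.

Definition cell (n : nat) := {c : 'I_n * 'I_n | in_staircase c}.

Definition row n (c : cell n) : 'I_n := (val c).1.
Definition col n (c : cell n) : 'I_n := (val c).2.

(* Cells hold arbitrary words; membership in [WI] forces them to be
   permutations. *)
Definition filling (n : nat) := {ffun cell n -> seq nat}.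

(* On words with distinct letters, the permutation in the same relative order. *)
Definition std (s : seq nat) : seq nat :=
  [seq count (fun y => y <= x) s | x <- s].

(* Meaningful when [s] has exactly [n] left-to-right minima. *)
Definition in_cell n (s : seq nat) (c : cell n) (k : nat) : bool :=
  [&& ~~ is_lrmin s k,
      lrmin_pos s (col c) < k,
      [forall j : 'I_n, (lrmin_pos s j < k) ==> (j <= col c)],
      lrmin_val s (row c) < nth 0 s k &
      [forall i : 'I_n, (lrmin_val s i < nth 0 s k) ==> (row c <= i)]].

Definition SE (n : nat) (s : seq nat) : filling n :=
  [ffun c : cell n =>
    std [seq nth 0 s k | k <- iota 0 (size s) & in_cell s c k]].

Definition down_edge n (c d : cell n) : bool :=
  [&& row c < row d, col c < col d &
      [forall x : 'I_n * 'I_n,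
         (row c <= x.1 <= row d) && (col c <= x.2 <= col d)
         ==> in_staircase x]].

Definition down_core (n : nat) : rel (cell n) :=
  fun c d => down_edge c d || down_edge d c.

Definition WI n (G : rel (cell n)) (S : set (seq nat)) : set (filling n) :=
  [set f | (forall c d, f c <> [::] -> f d <> [::] -> ~~ G c d) /\
           (forall c, f c <> [::] -> S (f c))].

(* Main.v *)
Require Import Defs.
From mathcomp Require Import all_boot.
From mathcomp Require Import boolp classical_sets functions.
From mathcomp Require Import zify.

Set Implicit Arguments.
Unset Strict Implicit.
Unset Printing Implicit Defensive.

(* Put the j-th left-to-right minimum in the diagonal cell (j, j), and view a
   cell (i, j) as the interval [i, j].  In a permutation avoiding 2413 and 3142,
   two entries in different cells form a descent exactly when their intervals are
   disjoint and an ascent exactly when the first interval is contained in the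
   second; so the occupied cells form a laminar family, which is independence in
   the down-core, and the contents of the cells determine the permutation.
   Conversely, an independent filling is assembled into a word by these rules.
   Laminarity forces an occurrence of 2413 or 3142 into a single cell.  In an
   occurrence of 1 + p, the cells of the entries of p all contain the interval of
   the first entry, hence form a chain along which the entries ascend, and an
   indecomposable p must lie in a single cell. *)

(** * Order isomorphism, occurrences and standardization *)

Lemma same_order_sym s t : same_order s t -> same_order t s.
Proof. by case=> e h; split=> // i j hi hj; rewrite h // e. Qed.

Lemma same_order_trans s t u :
  same_order s t -> same_order t u -> same_order s u.
Proof.
by case=> e h [e' h']; split=> [|i j hi hj]; [rewrite e | rewrite h // h' // -e].
Qed.

Lemma same_order_map (T : eqType) (a b : T -> nat) (I : seq T) :
  {in I &, forall x y, (a x < a y) = (b x < b y)} ->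
  same_order (map a I) (map b I).
Proof.
case: I => [|x0 I] h; first by split.
split=> [|i j]; rewrite !size_map // => hi hj.
by rewrite !(nth_map x0) // h ?mem_nth.
Qed.

Lemma same_order_mapE (T : eqType) (a b : T -> nat) (I : seq T) :
  same_order (map a I) (map b I) ->
  {in I &, forall x y, (a x < a y) = (b x < b y)}.
Proof.
move=> [_ h] x y hx hy; move: (h (index x I) (index y I)).
by rewrite size_map !index_mem !(nth_map x) ?index_mem // !nth_index //; apply.
Qed.

Lemma map_nth_iota_size (T : Type) (x0 : T) (s : seq T) :
  map (nth x0 s) (iota 0 (size s)) = s.
Proof. exact: mkseq_nth. Qed.

Lemma sub_iota_subseq I n :
  sorted ltn I -> all (gtn n) I -> subseq I (iota 0 n).
Proof.
move=> sI /allP hI; suff -> : I = [seq k <- iota 0 n | k \in I] by apply: filter_subseq.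
apply: (irr_sorted_eq ltn_trans ltnn) => //.
  by apply: sorted_filter; [exact: ltn_trans | exact: iota_ltn_sorted].
move=> k; rewrite mem_filter mem_iota /= add0n.
by case hk: (k \in I) => //=; have := hI _ hk; rewrite /= => ->.
Qed.

(** An occurrence is recorded by its positions rather than its letters, so that row and column
    labels, which depend on positions, can be attached to its entries. *)
Definition occurs_at (s p I : seq nat) : Prop :=
  [/\ sorted ltn I, all (gtn (size s)) I & same_order (map (nth 0 s) I) p].

Lemma containsP s p : contains s p <-> exists I, occurs_at s p I.
Proof.
split=> [[t /subseqP[m sm ->] h]|[I [sI hI h]]].
  exists (mask m (iota 0 (size s))); split.
  - exact: (subseq_sorted ltn_trans (mask_subseq _ _) (iota_ltn_sorted _ _)).
  - by apply/allP=> k /mem_mask; rewrite mem_iota.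
  - by rewrite map_mask map_nth_iota_size.
exists (map (nth 0 s) I) => //.
by rewrite -[X in subseq _ X](map_nth_iota_size 0 s) map_subseq // sub_iota_subseq.
Qed.

Lemma contains_same_order s t p : same_order s t -> contains s p -> contains t p.
Proof.
move=> [e h] /containsP[I [sI hI hp]]; apply/containsP; exists I; split=> //.
  by rewrite -e.
apply: same_order_trans hp; apply/same_order_sym/same_order_map => x y xI yI.
by rewrite h //; apply: (allP hI).
Qed.

Lemma size_std s : size (std s) = size s. Proof. exact: size_map. Qed.

(** If [x < y], every letter counted by the rank of [x] is counted by the rank of [y], and [y]
    itself is counted only by the latter; so ranks increase strictly. *)
Lemma same_order_std s : same_order s (std s).
Proof.
rewrite -{1}[s]map_id; apply: same_order_map => x y xs ys /=.
have mono a b : a <= b -> count (fun z => z <= a) s <= count (fun z => z <= b) s.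
  by move=> ab; apply: sub_count => z /= /leq_trans; apply.
case: ltnP => [xy|/mono]; last by case: ltnP.
have := count_predUI (fun z => z <= x) (pred1 y) s.
have -> : count (predI (fun z => z <= x) (pred1 y)) s = 0.
  apply/eqP; rewrite -leqn0 leqNgt -has_count; apply/hasPn => z _ /=.
  by apply/negP => /andP[zx /eqP e]; move: zx; rewrite e leqNgt xy.
have : 0 < count (pred1 y) s by rewrite -has_count has_pred1.
have : count (predU (fun z => z <= x) (pred1 y)) s <= count (fun z => z <= y) s.
  by apply: sub_count => z /= /orP[/leq_trans->//|/eqP->//]; apply: ltnW.
move=> h1 h2 h3; apply/esym/(leq_trans _ h1).
by rewrite -[X in _ < X]addn0 h3 -addn1 leq_add2l.
Qed.

(** In this form only comparisons between positions of [s] appear, which makes [std] visibly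
    invariant under [same_order]. *)
Lemma stdE s : std s =
  [seq count (fun j => nth 0 s j <= nth 0 s i) (iota 0 (size s)) | i <- iota 0 (size s)].
Proof.
have cE x : count (fun y => y <= x) s = count (fun j => nth 0 s j <= x) (iota 0 (size s)).
  by rewrite -{1}(map_nth_iota_size 0 s) count_map.
rewrite /std (eq_map cE); set F := (X in map X s = _).
by rewrite -{1}(map_nth_iota_size 0 s) -map_comp.
Qed.

Lemma eq_std s t : same_order s t -> std s = std t.
Proof.
move=> [e h]; rewrite !stdE -e; apply/eq_in_map => i; rewrite mem_iota => /= hi.
by apply: eq_in_count => j; rewrite mem_iota /= => hj; rewrite leqNgt [RHS]leqNgt h.
Qed.

Lemma is_perm_uniq s : is_perm s -> uniq s.
Proof. by move/perm_uniq->; apply: iota_uniq. Qed.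

Lemma count_leq_iota x n : x <= n -> count (fun y => y <= x) (iota 1 n) = x.
Proof.
move=> xn; rewrite -(subnKC xn) iotaD count_cat.
rewrite (_ : count _ (iota 1 x) = size (iota 1 x)); last first.
  apply/eqP; rewrite -all_count; apply/allP => y.
  by rewrite mem_iota add1n ltnS => /andP[].
rewrite size_iota (_ : count _ (iota (1 + x) _) = 0) ?addn0 //.
apply/eqP; rewrite -leqn0 leqNgt -has_count.
by apply/hasPn => y; rewrite mem_iota; lia.
Qed.

Lemma std_perm p : is_perm p -> std p = p.
Proof.
move=> hp; rewrite -[RHS]map_id; apply/eq_in_map => x.
rewrite (perm_mem hp) mem_iota => hx.
by rewrite (permP hp) count_leq_iota //; lia.
Qed.

Lemma perm_same_order s t : is_perm s -> is_perm t -> same_order s t -> s = t.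
Proof. by move=> /std_perm {2}<- /std_perm {2}<- /eq_std. Qed.

Lemma is_perm_std s : uniq s -> is_perm (std s).
Proof.
move=> us; have ut : uniq (std s).
  rewrite map_inj_in_uniq // => x y xs ys e.
  have := same_order_std s; rewrite -{1}[s]map_id => /same_order_mapE h.
  by have := h _ _ xs ys; have := h _ _ ys xs; rewrite /= e ltnn; lia.
have sub : {subset std s <= iota 1 (size (std s))}.
  move=> _ /mapP[x xs ->]; rewrite mem_iota size_std add1n ltnS count_size andbT.
  by rewrite -has_count; apply/hasP; exists x.
have [|_ h] := uniq_min_size ut sub; first by rewrite size_iota.
by rewrite /is_perm uniq_perm // iota_uniq.
Qed.

(** Since [u] lies below [v], sorting the two words separately and concatenating sorts the whole
    permutation into 1, 2, 3 and so on. Hence the values of [u] form an initial interval, and those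
    of [v] become a permutation after subtracting [size u]. *)
Lemma perm_osum u v : is_perm (u ++ v) ->
  (forall x y, x \in u -> y \in v -> x < y) ->
  exists2 w, is_perm u /\ is_perm w & u ++ v = osum u w.
Proof.
move=> hp lt.
have e : sort leq u ++ sort leq v = iota 1 (size u + size v).
  apply: (sorted_eq leq_trans anti_leq).
  - rewrite (sorted_pairwise leq_trans) pairwise_cat -!(sorted_pairwise leq_trans).
    rewrite !(sort_sorted leq_total) !andbT; apply/allrelP => x y.
    by rewrite !mem_sort => /lt h /h /ltnW.
  - exact: iota_sorted.
  - by rewrite -size_cat; apply: perm_trans hp; apply: perm_cat; rewrite perm_sort.
have [eu ev] : sort leq u = iota 1 (size u) /\ sort leq v = iota (1 + size u) (size v).
  move/eqP: e; rewrite iotaD eqseq_cat; first by move=> /andP[/eqP-> /eqP->].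
  by rewrite size_sort size_iota.
have vE : [seq x + size u | x <- [seq x - size u | x <- v]] = v.
  rewrite -map_comp -[RHS]map_id; apply/eq_in_map => x /=.
  by rewrite -(mem_sort leq) ev mem_iota; lia.
exists [seq x - size u | x <- v]; last by rewrite /osum vE.
split; first by rewrite /is_perm -eu perm_sym perm_sort.
rewrite /is_perm size_map; apply: (perm_map_inj (@addIn (size u))); rewrite vE.
have -> : [seq i + size u | i <- iota 1 (size v)] = iota (1 + size u) (size v).
  by rewrite addnC iotaDl; apply: eq_map => i; rewrite addnC.
by rewrite -ev perm_sym perm_sort.
Qed.

(** * Row and column labels of positions *)

Lemma nth_count_pairwise (T : Type) (x0 : T) (P : pred T) l j :
  pairwise (fun x y => P y ==> P x) l -> j < size l ->
  P (nth x0 l j) = (j < count P l).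
Proof.
elim: l j => [|x l IH] j //=; rewrite ?pairwise_cons => /andP[hx hl] hj.
case Px: (P x); first by case: j hj => [|j] //= hj; rewrite add1n ltnS IH.
have l0 : ~~ has P l.
  apply/negP => hP; have : ~~ all (predC P) l by rewrite all_predC negbK.
  by case/negP; apply: sub_all hx => y /=; rewrite Px implybF.
have c0 : count P l = 0 by apply/eqP; rewrite -leqn0 leqNgt -has_count.
by rewrite c0; case: j hj => [|j] //= hj; rewrite IH // c0.
Qed.

(** The index of the last left-to-right minimum weakly before [k]; the predecessor is due to
    counting columns from 0. A minimum is its own last one, so minima receive labels too. *)
Definition colof (s : seq nat) k := (count (fun p => p <= k) (lrmins s)).-1.

(** The minima decrease in value, so those above the entry at [k] are an initial segment, and their
    number is the index of the first minimum with value at most that of [k]. *)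
Definition rowof (s : seq nat) k :=
  count (fun p => nth 0 s k < nth 0 s p) (lrmins s).

Lemma is_lrminP s k : k < size s ->
  reflect (forall i, i < k -> nth 0 s k < nth 0 s i) (is_lrmin s k).
Proof.
move=> hk; apply: (iffP (all_nthP 0)) => h i; rewrite ?size_takel ?(ltnW hk) // => hi.
  by have := h i; rewrite size_takel ?(ltnW hk) // nth_take //; apply.
by rewrite nth_take //; apply: h.
Qed.

Lemma mem_lrmins s k : (k \in lrmins s) = (k < size s) && is_lrmin s k.
Proof. by rewrite mem_filter mem_iota andbC. Qed.

Lemma lrmins_sorted s : sorted ltn (lrmins s).
Proof. by apply: sorted_filter; [exact: ltn_trans | exact: iota_ltn_sorted]. Qed.

Lemma lrmin_pos_mem s j : j < size (lrmins s) ->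
  lrmin_pos s j < size s /\ is_lrmin s (lrmin_pos s j).
Proof. by move=> /(mem_nth 0); rewrite mem_lrmins => /andP. Qed.

Lemma ltn_lrmin_pos s i j : i < size (lrmins s) -> j < size (lrmins s) ->
  (lrmin_pos s i < lrmin_pos s j) = (i < j).
Proof.
have mono a b := @sorted_ltn_nth _ _ ltn_trans 0 _ (lrmins_sorted s) a b.
move=> hi hj; case: (ltngtP i j) => [ij|ji|->]; last by rewrite ltnn.
- exact: mono.
- by apply/negbTE; rewrite -leqNgt; apply/ltnW/mono.
Qed.

Lemma ltn_lrmin_val s i j : j < size (lrmins s) -> i < j ->
  lrmin_val s j < lrmin_val s i.
Proof.
move=> hj ij; have hi := ltn_trans ij hj.
have [hp /(is_lrminP hp)] := lrmin_pos_mem hj.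
by apply; rewrite ltn_lrmin_pos.
Qed.

Section Labels.
Variable s : seq nat.

Lemma lrmin_pos_leq j k : j < size (lrmins s) -> k < size s ->
  (lrmin_pos s j <= k) = (j <= colof s k).
Proof.
move=> hj hk; rewrite /lrmin_pos (@nth_count_pairwise _ 0 (fun p => p <= k)) //.
  (* Position 0 is always a left-to-right minimum, so the predecessor in [colof] does not
     truncate. *)
  have: 0 < count (fun p => p <= k) (lrmins s).
    rewrite -has_count; apply/hasP; exists 0 => //.
    rewrite mem_lrmins (leq_ltn_trans _ hk) //.
    by apply/is_lrminP; rewrite ?(leq_ltn_trans _ hk).
  by rewrite /colof; move: (count _ _) => c; lia.
have := lrmins_sorted s; rewrite (sorted_pairwise ltn_trans).
by apply: sub_pairwise => x y /= xy; apply/implyP; lia.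
Qed.

Lemma ltn_lrmin_val_row j k : j < size (lrmins s) ->
  (nth 0 s k < lrmin_val s j) = (j < rowof s k).
Proof.
move=> hj.
rewrite /lrmin_val /lrmin_pos.
rewrite (@nth_count_pairwise _ 0 (fun p => nth 0 s k < nth 0 s p)) //.
apply/(pairwiseP 0) => i l hi hl il; apply/implyP => /leq_trans; apply.
exact/ltnW/ltn_lrmin_val.
Qed.

Lemma exists_lrmin_below k : k < size s ->
  exists j, [/\ j < size (lrmins s), lrmin_pos s j <= k & lrmin_val s j <= nth 0 s k].
Proof.
elim/ltn_ind: k => k IH hk; case: (boolP (is_lrmin s k)) => [hm|].
  have km : k \in lrmins s by rewrite mem_lrmins hk.
  exists (index k (lrmins s)).
  by rewrite /lrmin_val /lrmin_pos index_mem km nth_index.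
case/allPn=> x /(nthP 0)[i]; rewrite size_takel ?(ltnW hk) // => ik.
rewrite nth_take // => <-; rewrite -leqNgt => hle.
have [j [hj h1 h2]] := IH i ik (ltn_trans ik hk).
by exists j; split=> //; [apply: leq_trans h1 (ltnW ik) | apply: leq_trans hle].
Qed.

Lemma colof_ltn k : k < size s -> colof s k < size (lrmins s).
Proof.
move=> hk; have [j [hj _ _]] := exists_lrmin_below hk.
by rewrite /colof; have := count_size (fun p => p <= k) (lrmins s); lia.
Qed.

Lemma row_leq_col k : k < size s -> rowof s k <= colof s k.
Proof.
move=> hk; have [j [hj h1 h2]] := exists_lrmin_below hk.
rewrite lrmin_pos_leq // in h1; apply: leq_trans h1.
by rewrite leqNgt -ltn_lrmin_val_row // -leqNgt.
Qed.

Lemma rowof_ltn k : k < size s -> rowof s k < size (lrmins s).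
Proof. by move=> hk; apply: leq_ltn_trans (row_leq_col hk) (colof_ltn hk). Qed.

Lemma lrmin_pos_label j : j < size (lrmins s) ->
  rowof s (lrmin_pos s j) = j /\ colof s (lrmin_pos s j) = j.
Proof.
move=> hj; have [hp _] := lrmin_pos_mem hj.
have cj : j <= colof s (lrmin_pos s j) by rewrite -lrmin_pos_leq.
have jc : colof s (lrmin_pos s j) <= j.
  by rewrite leqNgt -(@ltn_lrmin_pos s) ?colof_ltn // -leqNgt lrmin_pos_leq // colof_ltn.
have rj : rowof s (lrmin_pos s j) <= j.
  by rewrite leqNgt -ltn_lrmin_val_row // ltnn.
split; last lia; apply/eqP; rewrite eqn_leq rj leqNgt; apply/negP => h.
have := ltn_lrmin_val hj h.
by rewrite [lrmin_val s j]/lrmin_val ltn_lrmin_val_row ?ltnn // (ltn_trans h).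
Qed.

Lemma is_lrmin_label k : k < size s -> is_lrmin s k ->
  lrmin_pos s (colof s k) = k /\ rowof s k = colof s k.
Proof.
move=> hk km; have : k \in lrmins s by rewrite mem_lrmins hk.
case/(nthP 0) => j hj e; have [r c] := lrmin_pos_label hj.
by move: r c; rewrite /lrmin_pos e => -> ->.
Qed.

Lemma not_lrmin_label k : uniq s -> k < size s -> ~~ is_lrmin s k ->
  lrmin_pos s (colof s k) < k /\ lrmin_val s (rowof s k) < nth 0 s k.
Proof.
move=> us hk km; have hr := rowof_ltn hk; have hc := colof_ltn hk.
split.
  rewrite ltn_neqAle lrmin_pos_leq // leqnn andbT; apply/eqP => e.
  by have [_] := lrmin_pos_mem hc; rewrite e (negbTE km).
have [hp pm] := lrmin_pos_mem hr.
rewrite ltn_neqAle [X in _ && X]leqNgt ltn_lrmin_val_row // ltnn andbT.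
by apply/negP; rewrite nth_uniq // => /eqP e; rewrite e (negbTE km) in pm.
Qed.

Lemma colof_leq i j : i <= j -> colof s i <= colof s j.
Proof.
move=> ij; rewrite /colof -!subn1 leq_sub2r //; apply: sub_count => p /= h.
exact: leq_trans ij.
Qed.

Lemma rowof_leq i j : nth 0 s i <= nth 0 s j -> rowof s j <= rowof s i.
Proof. by move=> ij; apply: sub_count => p /=; apply: leq_ltn_trans. Qed.

(** A non-minimum never shares its position or value with a minimum, so the strict inequalities of
    [in_cell] agree with the weak ones that characterize the labels. *)
Lemma in_cellE n (c : cell n) k : uniq s -> size (lrmins s) = n -> k < size s ->
  in_cell s c k =
  [&& ~~ is_lrmin s k, rowof s k == row c & colof s k == col c].
Proof.
move=> us hn hk; rewrite /in_cell; case: (boolP (is_lrmin s k)) => //= km.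
have [hp hv] := not_lrmin_label us hk km.
have posE (j : 'I_n) : (lrmin_pos s j < k) = (j <= colof s k).
  have hj : j < size (lrmins s) by rewrite hn.
  rewrite -lrmin_pos_leq // ltn_neqAle andb_idl // => _; apply/eqP => e.
  by have [_] := lrmin_pos_mem hj; rewrite e (negbTE km).
have valE (j : 'I_n) : (lrmin_val s j < nth 0 s k) = (rowof s k <= j).
  have hj : j < size (lrmins s) by rewrite hn.
  rewrite [RHS]leqNgt -ltn_lrmin_val_row // -leqNgt ltn_neqAle andb_idl // => _.
  have [hq qm] := lrmin_pos_mem hj.
  by apply/negP; rewrite nth_uniq // => /eqP e; rewrite e (negbTE km) in qm.
have hr := rowof_ltn hk; have hc := colof_ltn hk; rewrite hn in hr hc.
rewrite posE valE.
apply/and4P/andP => [[h1 /forallP h2 h3 /forallP h4]|[/eqP h1 /eqP h2]].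
  have := h2 (Ordinal hc); have := h4 (Ordinal hr).
  by rewrite posE valE /= !leqnn /= !eqn_leq h1 h3 => -> ->.
rewrite h1 h2; split=> //; apply/forallP => j; rewrite ?posE ?valE ?h1 ?h2;
  exact: implybb.
Qed.

End Labels.

(** * Laminarity from avoidance of 2413 and 3142 *)

Lemma contains2413 s :
  contains s [:: 2; 4; 1; 3] <->
  exists a b c d, [/\ a < b, b < c, c < d & d < size s] /\
    [/\ nth 0 s c < nth 0 s a, nth 0 s a < nth 0 s d & nth 0 s d < nth 0 s b].
Proof.
split=> [/containsP[I [sI hI [eI h]]]|[a [b [c [d [[ab bc cd hd] [ca ad db]]]]]]].
  move: I sI hI eI h => [|a[|b[|c[|d[|]]]]] //= /and4P[ab bc cd _] hI _ h.
  exists a, b, c, d; split; first by split=> //; move: hI; lia.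
  by split; [have := h 2 0 | have := h 0 3 | have := h 3 1]; move=> /= ->.
apply/containsP; exists [:: a; b; c; d]; split=> /=; first lia.
  by rewrite /=; lia.
by split=> // -[|[|[|[|i]]]] // [|[|[|[|j]]]] //= _ _; apply/idP/idP; lia.
Qed.

Lemma contains3142 s :
  contains s [:: 3; 1; 4; 2] <->
  exists a b c d, [/\ a < b, b < c, c < d & d < size s] /\
    [/\ nth 0 s b < nth 0 s d, nth 0 s d < nth 0 s a & nth 0 s a < nth 0 s c].
Proof.
split=> [/containsP[I [sI hI [eI h]]]|[a [b [c [d [[ab bc cd hd] [ca ad db]]]]]]].
  move: I sI hI eI h => [|a[|b[|c[|d[|]]]]] //= /and4P[ab bc cd _] hI _ h.
  exists a, b, c, d; split; first by split=> //; move: hI; lia.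
  by split; [have := h 1 3 | have := h 3 0 | have := h 0 2]; move=> /= ->.
apply/containsP; exists [:: a; b; c; d]; split=> /=; first lia.
  by rewrite /=; lia.
by split=> // -[|[|[|[|i]]]] // [|[|[|[|j]]]] //= _ _; apply/idP/idP; lia.
Qed.

(* Position [k] carries the interval [r k, c k]. *)
Definition laminar (s : seq nat) (r c : nat -> nat) : Prop :=
  forall i j, i < j -> j < size s ->
  [\/ r i = r j /\ c i = c j,
      nth 0 s j < nth 0 s i /\ c i < r j
    | [/\ nth 0 s i < nth 0 s j, r j <= r i & c i <= c j]].

(** An ascent nests the intervals by monotonicity of the labels. In a descent with meeting intervals
    neither entry is a minimum; different columns then produce a 2413 and different rows a 3142,
    both completed by left-to-right minima. *)
Lemma laminar_label s : uniq s ->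
  ~ contains s [:: 2; 4; 1; 3] -> ~ contains s [:: 3; 1; 4; 2] ->
  laminar s (rowof s) (colof s).
Proof.
move=> us no1 no2 i j ij hj; have hi := ltn_trans ij hj.
have cij := colof_leq s (ltnW ij).
have rci := row_leq_col hi; have rcj := row_leq_col hj.
have hri := rowof_ltn hi; have hci := colof_ltn hi.
have hrj := rowof_ltn hj; have hcj := colof_ltn hj.
have : nth 0 s i != nth 0 s j by rewrite nth_uniq // neq_ltn ij.
rewrite neq_ltn => /orP[lt|gt]; first by constructor 3; split=> //; apply/rowof_leq/ltnW.
have rij := rowof_leq (ltnW gt).
have jN : colof s i = colof s j \/ rowof s j <= colof s i -> ~~ is_lrmin s j.
  move=> h; apply/negP => /(is_lrmin_label hj)[ej e].
  have : lrmin_pos s (colof s j) <= i by rewrite lrmin_pos_leq //; lia.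
  lia.
have iN : rowof s j <= colof s i -> ~~ is_lrmin s i.
  move=> h; apply/negP => /(is_lrmin_label hi)[ei e].
  have : ~~ (nth 0 s j < lrmin_val s (rowof s j)) by rewrite ltn_lrmin_val_row // ltnn.
  have -> : rowof s j = colof s i by lia.
  by rewrite /lrmin_val ei gt.
case: (leqP (rowof s j) (colof s i)) => [le|]; last by constructor 2.
have [pi vi] := not_lrmin_label us hi (iN le).
have [pj vj] := not_lrmin_label us hj (jN (or_intror le)).
have prj : lrmin_pos s (rowof s j) < i.
  by apply: leq_ltn_trans pi; rewrite leqNgt ltn_lrmin_pos // -leqNgt.
case: (ltnP (colof s i) (colof s j)) => [lt|ge].
  case: no1; apply/contains2413.
  (* The minimum of the row of [j] plays 2 and the minimum of the column of [j] plays 1; the latter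
     lies between [i] and [j] because the columns differ. *)
  exists (lrmin_pos s (rowof s j)), i, (lrmin_pos s (colof s j)), j.
  do 2!split=> //; first by rewrite ltnNge lrmin_pos_leq // -ltnNge.
  by apply: ltn_lrmin_val => //; lia.
case: (ltnP (rowof s i) (rowof s j)) => [lt|ge']; last by constructor 1; lia.
case: no2; apply/contains3142.
have r1 : (rowof s j).-1 < size (lrmins s) by lia.
(* The minimum of the row of [j] plays 1. The preceding minimum plays 3: it is above the entry at
   [j] but, the row of [i] being smaller, still below the entry at [i]. *)
exists (lrmin_pos s (rowof s j).-1), (lrmin_pos s (rowof s j)), i, j.
split; split=> //; first by rewrite ltn_lrmin_pos //; lia.
  by rewrite -/(lrmin_val s _) ltn_lrmin_val_row //; lia.
apply: leq_ltn_trans vi; rewrite -/(lrmin_val s _).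
case: (ltngtP (rowof s i) (rowof s j).-1) => [h|h|->//]; last lia.
exact/ltnW/ltn_lrmin_val.
Qed.

(** * Contents of the cells, and independence of the occupied cells *)

Lemma contains_std_filter s (Q : pred nat) p :
  contains (std [seq nth 0 s k | k <- iota 0 (size s) & Q k]) p <->
  exists2 I, occurs_at s p I & all Q I.
Proof.
set K := filter _ _; have sK : sorted ltn K.
  by apply: sorted_filter; [exact: ltn_trans | exact: iota_ltn_sorted].
split=> [/(contains_same_order (same_order_sym (same_order_std _)))[t]|[I [sI hI h] QI]].
  case/subseqP=> m _ -> h; exists (mask m K).
    split; last by rewrite map_mask.
    - exact: (subseq_sorted ltn_trans (mask_subseq _ _) sK).
    - by apply/allP=> k /mem_mask; rewrite mem_filter mem_iota => /andP[].
  by apply/allP=> k /mem_mask; rewrite mem_filter => /andP[].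
apply: (contains_same_order (same_order_std _)).
exists (map (nth 0 s) I) => //; apply: map_subseq.
by rewrite subseq_filter QI sub_iota_subseq.
Qed.

Lemma mem_perm_gt0 p x : is_perm p -> x \in p -> 0 < x.
Proof. by move=> /perm_mem->; rewrite mem_iota => /andP[]. Qed.

(** The left-to-right minimum of the cell's row lies to the left of and below every entry of the
    cell, so it can be put in front of an occurrence of [p] as the initial 1. *)
Lemma contains_SE n s (c : cell n) p : uniq s -> size (lrmins s) = n ->
  is_perm p -> contains (SE n s c) p -> contains s (osum [:: 1] p).
Proof.
move=> us hn pp; rewrite ffunE => /contains_std_filter[I [sI hI [eI h]] QI].
have hrn : row c < size (lrmins s) by rewrite hn.
have below k : k \in I -> lrmin_pos s (row c) < k /\ lrmin_val s (row c) < nth 0 s k.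
  move=> kI; have hk := allP hI _ kI; have := allP QI _ kI.
  rewrite in_cellE // => /and3P[km /eqP er ec].
  have [hc hv] := not_lrmin_label us hk km; rewrite -er; split=> //.
  apply: leq_ltn_trans hc.
  by rewrite leqNgt ltn_lrmin_pos ?colof_ltn ?rowof_ltn // -leqNgt row_leq_col.
rewrite size_map in eI h.
apply/containsP; exists (lrmin_pos s (row c) :: I); split.
- by rewrite /= (path_sortedE ltn_trans) sI andbT; apply/allP=> k /below[].
- by rewrite /= hI andbT; have [] := lrmin_pos_mem hrn.
split=> [|i j]; rewrite /= ?size_map ?eI // -eI !ltnS.
case: i j => [|i] [|j] hi hj //=; rewrite ?ltnn //.
- rewrite (nth_map 0) -?eI // (nth_map 0) -?eI // addn1 ltnS.
  rewrite (mem_perm_gt0 pp) ?mem_nth -?eI //.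
  by have [] := below _ (mem_nth 0 hj).
- rewrite (nth_map 0) -?eI // (nth_map 0) -?eI // addn1 !ltnS leqn0.
  have [_ /ltnW] := below _ (mem_nth 0 hi); rewrite leqNgt => /negbTE->.
  have : 0 < nth 0 p i by rewrite (mem_perm_gt0 pp) // mem_nth -?eI.
  by lia.
rewrite h // !(nth_map 0 _ (fun x => x + 1)) -?eI // !addn1 ltnS //.
Qed.

Lemma exists_cell n i j : i <= j -> j < n ->
  exists c : cell n, row c = i :> nat /\ col c = j :> nat.
Proof.
move=> ij jn; have hi := leq_ltn_trans ij jn.
have st : in_staircase (Ordinal hi, Ordinal jn) by [].
by exists (Sub _ st); rewrite /row /col SubK.
Qed.

(** A rectangle lies in the staircase exactly when its lower left corner does. An edge therefore
    joins two intervals that overlap without being nested. *)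
Lemma down_edgeE n (c d : cell n) :
  down_edge c d = [&& row c < row d, col c < col d & row d <= col c].
Proof.
rewrite /down_edge; case: ltnP => //= hr; case: ltnP => //= hc.
apply/forallP/idP => [/(_ (row d, col c))|h [x y]] /=.
  by rewrite /in_staircase /= !leqnn (ltnW hr) (ltnW hc).
by rewrite /in_staircase /=; apply/implyP; lia.
Qed.

Lemma SE_neq0 n s (c : cell n) : uniq s -> size (lrmins s) = n ->
  SE n s c <> [::] ->
  exists k, [/\ k < size s, rowof s k = row c & colof s k = col c].
Proof.
move=> us hn; rewrite ffunE; case K: (filter _ _) => [|k K'] // _.
have : k \in [seq k <- iota 0 (size s) | in_cell s c k] by rewrite K mem_head.
rewrite mem_filter mem_iota /= add0n => /andP[ck hk].
by move: ck; rewrite in_cellE // => /and3P[_ /eqP rk /eqP ck]; exists k.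
Qed.

Lemma SE_independent n s (c d : cell n) : uniq s -> size (lrmins s) = n ->
  laminar s (rowof s) (colof s) ->
  SE n s c <> [::] -> SE n s d <> [::] -> ~~ down_core c d.
Proof.
move=> us hn lam.
have main (x y : cell n) : SE n s x <> [::] -> SE n s y <> [::] -> ~~ down_edge x y.
  move=> /SE_neq0[] // k [hk rk ck] /SE_neq0[] // l [hl rl cl].
  rewrite down_edgeE -rk -ck -rl -cl; apply/negP => /and3P[h1 h2 h3].
  have kl : k < l by rewrite ltnNge; apply/negP => /(colof_leq s); lia.
  by case: (lam _ _ kl hl) => [[]|[]|[]]; lia.
by move=> hc hd; rewrite /down_core negb_or !main.
Qed.

(** * Injectivity of the encoding *)

Definition label s k := (rowof s k, colof s k).

(** The order in which a laminar word visits the cells from left to right: by columns, and from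
    bottom to top within a column. *)
Definition pos_le (x y : nat * nat) := (x.2 < y.2) || (x.2 == y.2) && (y.1 <= x.1).

Lemma pos_le_trans : transitive pos_le.
Proof. by move=> [a b] [c d] [e f]; rewrite /pos_le /=; lia. Qed.

Lemma pos_le_anti : antisymmetric pos_le.
Proof.
move=> [a b] [c d]; rewrite /pos_le /= => h.
by congr (_, _); lia.
Qed.

Lemma pos_le_total : total pos_le.
Proof. by move=> [a b] [c d]; rewrite /pos_le /=; lia. Qed.

Lemma label_sorted s : laminar s (rowof s) (colof s) ->
  pairwise pos_le (map (label s) (iota 0 (size s))).
Proof.
move=> lam; rewrite pairwise_map.
have := iota_ltn_sorted 0 (size s); rewrite (sorted_pairwise ltn_trans).
apply: (@sub_in_pairwise _ (gtn (size s))); last first.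
  by apply/allP => k; rewrite mem_iota.
move=> i j hi hj /= ij; rewrite /pos_le /=.
have := row_leq_col hj; have := colof_leq s (ltnW ij).
by case: (lam _ _ ij hj) => [[]|[]|[]]; lia.
Qed.

Lemma lrminsE s : lrmins s = map (lrmin_pos s) (iota 0 (size (lrmins s))).
Proof. by rewrite map_nth_iota_size. Qed.

(** The encoding determines the multiset of labels: each diagonal label is taken once by a minimum,
    and the other entries are counted by the sizes of the cells' contents. *)
Lemma count_label n s x : uniq s -> size (lrmins s) = n ->
  count_mem x (map (label s) (iota 0 (size s))) =
  count (fun j => (j, j) == x) (iota 0 n) +
  if [pick c : cell n | ((row c : nat), (col c : nat)) == x] is Some c
  then size (SE n s c) else 0.
Proof.
move=> us hn.
rewrite count_map -(permP (permEl (perm_filterC (is_lrmin s) (iota 0 (size s))))).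
rewrite count_cat -/(lrmins s).
congr (_ + _).
  rewrite lrminsE count_map hn; apply: eq_in_count => j; rewrite mem_iota /= => hj.
  by rewrite /label; have [|-> ->] := @lrmin_pos_label s j; rewrite ?hn.
rewrite count_filter; case: pickP => [c /eqP <-|no].
  rewrite ffunE size_std size_map size_filter; apply: eq_in_count => k.
  rewrite mem_iota /= => hk; rewrite in_cellE // andbC.
  by rewrite /label xpair_eqE.
apply/eqP; rewrite -leqn0 leqNgt -has_count; apply/hasPn => k; rewrite mem_iota /= => hk.
apply/negP => /andP[/eqP e _].
have [|c [rc cc]] := @exists_cell n _ _ (row_leq_col hk); first by rewrite -hn colof_ltn.
by have := no c; rewrite rc cc -e eqxx.
Qed.

(** Each column starts with its minimum; thus the column labels alone determine which positions are
    minima. *)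
Lemma is_lrmin_first_col s k : k < size s ->
  is_lrmin s k = ~~ has (fun i => colof s i == colof s k) (iota 0 k).
Proof.
move=> hk; apply/idP/hasPn => [km i|no].
  rewrite mem_iota /= add0n => ik; apply/eqP => e.
  have [ek _] := is_lrmin_label hk km.
  have : lrmin_pos s (colof s k) <= i.
    by rewrite lrmin_pos_leq ?colof_ltn ?e // (ltn_trans ik).
  by rewrite ek leqNgt ik.
have hc := colof_ltn hk; have [_ ec] := lrmin_pos_label hc.
have le : lrmin_pos s (colof s k) <= k by rewrite lrmin_pos_leq.
case: (ltngtP (lrmin_pos s (colof s k)) k) le => // [lt|<-] _; last first.
  by have [] := lrmin_pos_mem hc.
by have := no (lrmin_pos s (colof s k)); rewrite mem_iota lt ec eqxx => /(_ isT).
Qed.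

(** The label sequences are sorted by [pos_le] and have equal multisets, so they coincide. Entries
    with different labels are then compared through the labels by laminarity, and entries with the
    same label through the contents of the cell or, if one is a minimum, because it is the
    lowest. *)
Lemma SE_same_order n s t : uniq s -> uniq t ->
  size (lrmins s) = n -> size (lrmins t) = n ->
  laminar s (rowof s) (colof s) -> laminar t (rowof t) (colof t) ->
  SE n s = SE n t -> same_order s t.
Proof.
move=> us ut hs ht ls lt e.
have eL : map (label s) (iota 0 (size s)) = map (label t) (iota 0 (size t)).
  apply: (pairwise_eq pos_le_anti); [exact: label_sorted | exact: label_sorted |].
  apply/allP => x _ /=; rewrite (count_label x us hs) (count_label x ut ht).
  by case: pickP => // c _; rewrite e.
have es : size s = size t by have := congr1 size eL; rewrite !size_map !size_iota.
have lab k : k < size s -> label s k = label t k.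
  by move=> hk; move: eL; rewrite -es => /eq_in_map; apply; rewrite mem_iota.
have er k : k < size s -> rowof s k = rowof t k by move=> /lab[].
have ec k : k < size s -> colof s k = colof t k by move=> /lab[].
have em k : k < size s -> is_lrmin s k = is_lrmin t k.
  move=> hk; rewrite !is_lrmin_first_col -?es //; congr (~~ _).
  apply: eq_in_has => i; rewrite mem_iota add0n /= => ik.
  by rewrite !ec // (ltn_trans ik).
have main i j : i < j -> j < size s ->
    (nth 0 s i < nth 0 s j) = (nth 0 t i < nth 0 t j).
  move=> ij hj; have hi := ltn_trans ij hj; have hjt : j < size t by rewrite -es.
  have hit : i < size t by rewrite -es.
  case: (eqVneq (label s i) (label s j)) => [el|ne]; last first.
    have := row_leq_col hi; have := row_leq_col hj.
    have := ls _ _ ij hj; have := lt _ _ ij hjt; rewrite -!er // -!ec //.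
    move: ne; rewrite xpair_eqE => ne.
    (* For non-empty intervals disjointness and containment exclude each other, so the two words
       must fall into the same alternative. *)
    by case=> [[? ?]|[? ?]|[? ? ?]] [[? ?]|[? ?]|[? ? ?]] ? ?; lia.
  have jm : ~~ is_lrmin s j.
    rewrite is_lrmin_first_col // negbK; apply/hasP; exists i.
      by rewrite mem_iota.
    by case: el => _ ->.
  have jmt : ~~ is_lrmin t j by rewrite -em.
  case: (boolP (is_lrmin s i)) => im.
    have low u : uniq u -> j < size u -> is_lrmin u i -> ~~ is_lrmin u j ->
        label u i = label u j -> nth 0 u i < nth 0 u j.
      move=> uu hju imu jmu [eru _]; have hiu := ltn_trans ij hju.
      have [p r] := is_lrmin_label hiu imu.
      have [_] := not_lrmin_label uu hju jmu.
      by rewrite -eru r /lrmin_val p.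
    by rewrite !low // -?em // -!lab.
  have [|c [rc cc]] := @exists_cell n _ _ (row_leq_col hj).
    by rewrite -hs colof_ltn.
  have := congr1 (fun f : filling n => f c) e; rewrite !ffunE => ef.
  have Ks k : k < size s -> in_cell s c k = ~~ is_lrmin s k && (label s k == label s j).
    by move=> hk; rewrite in_cellE // rc cc.
  have Kt k : k < size s -> in_cell t c k = in_cell s c k.
    move=> hk; rewrite Ks // in_cellE // -?es //.
    by rewrite rc cc -em // -er // -ec.
  have eK : [seq k <- iota 0 (size t) | in_cell t c k] =
            [seq k <- iota 0 (size s) | in_cell s c k].
    by rewrite -es; apply/eq_in_filter => k; rewrite mem_iota => /Kt.
  rewrite eK in ef.
  set K := filter _ _ in ef.
  have so : same_order (map (nth 0 s) K) (map (nth 0 t) K).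
    apply: same_order_trans (same_order_std _) _; rewrite ef.
    exact/same_order_sym/same_order_std.
  by apply: (same_order_mapE so); rewrite mem_filter mem_iota Ks // ?im ?jm ?el eqxx.
split=> // i j hi hj; case: (ltngtP i j) => [ij|ji|->];
  first exact: main; last by rewrite !ltnn.
have := main _ _ ji hi.
have : nth 0 s i != nth 0 s j by rewrite nth_uniq // gtn_eqF.
have : nth 0 t i != nth 0 t j by rewrite nth_uniq -?es // gtn_eqF.
by lia.
Qed.

(** * Bringing occurrences of patterns into a single cell *)

Lemma lrmin_min_label s i j : uniq s -> i < size s -> j < size s -> i <> j ->
  label s i = label s j -> is_lrmin s i -> i < j /\ nth 0 s i < nth 0 s j.
Proof.
move=> us hi hj ij [er ec] im; have [ei eri] := is_lrmin_label hi im.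
have lt : i < j.
  have : i <= j by rewrite -ei lrmin_pos_leq ?colof_ltn // ec.
  by lia.
have jm : ~~ is_lrmin s j.
  rewrite is_lrmin_first_col // negbK; apply/hasP; exists i; first by rewrite mem_iota.
  by rewrite ec.
by have [_] := not_lrmin_label us hj jm; rewrite -er eri /lrmin_val ei.
Qed.

Section Laminar.
Variables (s : seq nat) (n : nat).
Hypotheses (us : uniq s) (hn : size (lrmins s) = n).
Hypothesis lam : laminar s (rowof s) (colof s).

Lemma laminar_desc i j : i < j -> j < size s -> nth 0 s j < nth 0 s i ->
  (rowof s i = rowof s j /\ colof s i = colof s j) \/ colof s i < rowof s j.
Proof. by move=> ij hj v; case: (lam ij hj) => [|[]|[]]; [left | right | lia]. Qed.

Lemma laminar_asc i j : i < j -> j < size s -> nth 0 s i < nth 0 s j ->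
  rowof s j <= rowof s i /\ colof s i <= colof s j.
Proof. by move=> ij hj v; case: (lam ij hj) => [[-> ->]|[]|[]]; [|lia|]. Qed.

Lemma contains_in_cell p I k : occurs_at s p I -> k < size s ->
  (forall i, i \in I -> label s i = label s k /\ ~~ is_lrmin s i) ->
  exists c, contains (SE n s c) p.
Proof.
move=> oI hk hI.
have [|c [rc cc]] := @exists_cell n _ _ (row_leq_col hk); first by rewrite -hn colof_ltn.
exists c; rewrite ffunE; apply/contains_std_filter; exists I => //.
apply/allP => i iI; have [_ hs _] := oI.
have [[er ec] im] := hI i iI.
by rewrite in_cellE ?im ?er ?ec ?rc ?cc ?eqxx //; apply: (allP hs).
Qed.

(** The intervals of 4 and 3 both contain that of 2, so they meet, and being a descent they
    coincide. This common interval contains that of 1, so the descent 41 forces equality there, and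
    then so does the descent 21. *)
Lemma contains_SE_2413 : contains s [:: 2; 4; 1; 3] ->
  exists c, contains (SE n s c) [:: 2; 4; 1; 3].
Proof.
move=> cs; have /contains2413[a [b [c [d [[ab bc cd hd] [ca ad db]]]]]] := cs.
have hc := ltn_trans cd hd; have hb := ltn_trans bc hc; have ha := ltn_trans ab hb.
have := row_leq_col ha; have := row_leq_col hb; have := row_leq_col hc.
have := row_leq_col hd => rd rc rb ra.
have [B C D] : [/\ label s b = label s a, label s c = label s a & label s d = label s a].
  have := laminar_asc ab hb (ltn_trans ad db).
  have := laminar_asc (ltn_trans ab (ltn_trans bc cd)) hd ad.
  have := laminar_asc cd hd (ltn_trans ca ad).
  have := laminar_desc (ltn_trans ab bc) hc ca.
  have := laminar_desc bc hc (ltn_trans ca (ltn_trans ad db)).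
  have := laminar_desc (ltn_trans bc cd) hd db.
  by rewrite /label; split; congr (_, _); lia.
(* A minimum is the first and lowest entry with its label. The entry 2 is not the lowest, and the
   later entries are not the first. *)
have am : ~~ is_lrmin s a.
  by apply/negP => /(lrmin_min_label us ha hc) []; [lia | | lia].
have nm k : label s k = label s a -> a < k -> k < size s -> ~~ is_lrmin s k.
  by move=> e ak hk; apply/negP => /(lrmin_min_label us hk ha) []; [lia | | lia].
apply: (@contains_in_cell _ [:: a; b; c; d] a) => //.
  split=> /=; rewrite ?ab ?bc ?cd ?ha ?hb ?hc ?hd //.
  by split=> // -[|[|[|[|i]]]] // [|[|[|[|j]]]] //= _ _; apply/idP/idP; lia.
by move=> k; rewrite !inE => /or4P[]/eqP->; split=> //; apply: nm => //; lia.
Qed.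

(** Here 4 and 2 both contain the interval of 1, so their intervals coincide; the descents 32 and 31
    then force the other two. *)
Lemma contains_SE_3142 : contains s [:: 3; 1; 4; 2] ->
  exists c, contains (SE n s c) [:: 3; 1; 4; 2].
Proof.
move=> cs; have /contains3142[a [b [c [d [[ab bc cd hd] [bd da ac]]]]]] := cs.
have hc := ltn_trans cd hd; have hb := ltn_trans bc hc; have ha := ltn_trans ab hb.
have := row_leq_col ha; have := row_leq_col hb; have := row_leq_col hc.
have := row_leq_col hd => rd rc rb ra.
have [B C D] : [/\ label s b = label s a, label s c = label s a & label s d = label s a].
  have := laminar_desc ab hb (ltn_trans bd da).
  have := laminar_desc (ltn_trans ab (ltn_trans bc cd)) hd da.
  have := laminar_desc cd hd (ltn_trans da ac).
  have := laminar_asc (ltn_trans ab bc) hc ac.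
  have := laminar_asc bc hc (ltn_trans bd (ltn_trans da ac)).
  have := laminar_asc (ltn_trans bc cd) hd bd.
  by rewrite /label; split; congr (_, _); lia.
have am : ~~ is_lrmin s a.
  by apply/negP => /(lrmin_min_label us ha hb) []; [lia | | lia].
have nm k : label s k = label s a -> a < k -> k < size s -> ~~ is_lrmin s k.
  by move=> e ak hk; apply/negP => /(lrmin_min_label us hk ha) []; [lia | | lia].
apply: (@contains_in_cell _ [:: a; b; c; d] a) => //.
  split=> /=; rewrite ?ab ?bc ?cd ?ha ?hb ?hc ?hd //.
  by split=> // -[|[|[|[|i]]]] // [|[|[|[|j]]]] //= _ _; apply/idP/idP; lia.
by move=> k; rewrite !inE => /or4P[]/eqP->; split=> //; apply: nm => //; lia.
Qed.

(* All intervals of cells meeting the upper right quadrant of [x] contain the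
   interval of [x], so they form a chain, along which the entries ascend. *)
Lemma quadrant_chain x i j : x < i -> i < j -> j < size s ->
  nth 0 s x < nth 0 s i -> nth 0 s x < nth 0 s j ->
  label s i = label s j \/
  [/\ nth 0 s i < nth 0 s j, rowof s j <= rowof s i & colof s i <= colof s j].
Proof.
move=> xi ij hj vi vj; have hi := ltn_trans ij hj.
have hx := row_leq_col (ltn_trans xi hi).
have := lam xi hi; have := lam (ltn_trans xi ij) hj; have := lam ij hj.
case=> [[h1 h2]|[h1 h2]|h]; [by left; congr (_, _) | | by right].
by case=> [[? ?]|[? ?]|[? ? ?]] [[? ?]|[? ?]|[? ? ?]]; lia.
Qed.

(** Cut [J] at the first entry [a] whose label differs from that of the head. If such an entry
    exists, everything before the cut is below everything after it, and [p] splits as a sum of two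
    non-empty permutations. *)
Lemma indecomposable_same_label x J p : sum_indecomposable p -> is_perm p ->
  path ltn x J -> all (gtn (size s)) J ->
  (forall i, i \in J -> nth 0 s x < nth 0 s i) ->
  same_order (map (nth 0 s) J) p ->
  forall i, i \in J -> label s i = label s (head 0 J).
Proof.
move=> ind pp xJ hJ vJ [eJ h]; rewrite size_map in eJ h.
have sJ := path_sorted xJ.
move: xJ; rewrite (path_sortedE ltn_trans) => /andP[/allP xJ _].
apply/eq_in_map/eqP; rewrite -[_ == _]negbK; apply/negP => ne; apply: ind.
pose Q k := label s k != label s (head 0 J).
have hasQ : has Q J.
  apply: contraNT ne => /hasPn no; apply/eqP/eq_in_map => i /no.
  by rewrite negbK => /eqP.
pose a := find Q J; have aJ : a < size J by rewrite -has_find.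
have a0 : 0 < a.
  rewrite lt0n; apply/eqP => a0; have := nth_find 0 hasQ; rewrite -/a a0 nth0.
  by rewrite /Q eqxx.
have Qa : Q (nth 0 J a) by apply: nth_find.
have pre i : i < a -> label s (nth 0 J i) = label s (head 0 J).
  by move=> ia; have := before_find 0 ia; rewrite /Q => /negbFE/eqP.
have chain i j : i < j -> j < size J -> let u := nth 0 J i in let v := nth 0 J j in
    label s u = label s v \/
    [/\ nth 0 s u < nth 0 s v, rowof s v <= rowof s u & colof s u <= colof s v].
  move=> ij hj u v; have hi := ltn_trans ij hj.
  have uJ : u \in J by rewrite mem_nth.
  have wJ : v \in J by rewrite mem_nth.
  apply: (@quadrant_chain x); rewrite ?xJ ?vJ //.
  - exact: (sorted_ltn_nth ltn_trans 0 sJ).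
  - exact: (allP hJ).
(* Labels only grow along the chain. If the label at [j] were that of the head again, the label at
   [a], squeezed between equal intervals, would be too. *)
have asc i j : i < a -> a <= j -> j < size J ->
    nth 0 s (nth 0 J i) < nth 0 s (nth 0 J j).
  move=> ia aj hj; have ij := leq_trans ia aj.
  have [e|[]//] := chain i j ij hj.
  move: Qa; rewrite /Q -(pre i ia) => /negP; case.
  have := chain i a ia aJ; rewrite /= => -[->//|[_ r1 c1]].
  case: (ltngtP a j) aj e => // [aj _ e|-> _ -> //].
  have := chain a j aj hj; rewrite /= => -[e'|[_ r2 c2]]; first by rewrite e' e.
  by case: e => e1 e2; rewrite xpair_eqE; lia.
have := @perm_osum (take a p) (drop a p); rewrite cat_take_drop => /(_ pp) [].
  move=> y z /(nthP 0)[i]; rewrite size_takel -?eJ ?(ltnW aJ) // => ia.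
  rewrite nth_take // => <- /(nthP 0)[j]; rewrite size_drop -eJ => ja.
  rewrite nth_drop => <-.
  have hi : i < size J by apply: ltn_trans aJ.
  have hj : a + j < size J by lia.
  by rewrite -h // !(nth_map 0) // asc // leq_addr.
move=> w [pu pw] e; exists (take a p), w; split=> //.
  by move/(congr1 size); rewrite size_takel -?eJ ?(ltnW aJ) //= => a00; rewrite a00 in a0.
move=> w0; have := congr1 size e; rewrite w0 /osum cats0 size_takel -?eJ ?(ltnW aJ) //.
by move=> ae; rewrite ae ltnn in aJ.
Qed.

Lemma contains_SE_osum p : is_perm p -> p <> [::] -> sum_indecomposable p ->
  contains s (osum [:: 1] p) -> exists c, contains (SE n s c) p.
Proof.
move=> pp p0 ind /containsP[[|x J] [sI hI [eI h]]] //.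
rewrite /= in sI hI eI h; rewrite !size_map in eI h; case: eI => eI.
case/andP: hI => hx hJ.
have vJ i : i \in J -> nth 0 s x < nth 0 s i.
  move=> iJ; have := h 0 (index i J).+1 isT; rewrite ltnS index_mem => /(_ iJ) /=.
  rewrite (nth_map 0) ?index_mem // nth_index // => ->.
  rewrite (nth_map 0) -?eI ?index_mem // addn1 ltnS (mem_perm_gt0 pp) //.
  by rewrite mem_nth // -eI index_mem.
have so : same_order (map (nth 0 s) J) p.
  split=> [|i j]; rewrite !size_map // => hi hj.
  have := h i.+1 j.+1; rewrite !ltnS => /(_ hi hj) /= ->.
  by rewrite !(nth_map 0 _ (fun x => x + 1)) -?eI // !addn1 ltnS.
have same := indecomposable_same_label ind pp sI hJ vJ so.
have J0 : head 0 J \in J.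
  by case: (J) eI => [|j J'] //=; [case: (p) p0 | rewrite mem_head].
apply: (@contains_in_cell _ J (head 0 J)).
- by split=> //; apply: path_sorted sI.
- exact: (allP hJ).
move=> i iJ; split; first exact: same.
have hi : i < size s by apply: (allP hJ).
have xi : x < i by move: sI; rewrite (path_sortedE ltn_trans) => /andP[/allP/(_ i iJ)].
(* The entry playing the initial 1 precedes every entry of [J] and is smaller, so none of them is a
   minimum. *)
apply/negP => /(is_lrminP hi)/(_ x xi); have := vJ i iJ; lia.
Qed.

End Laminar.

(** * Recognizing the row and column labels from an abstract laminar labelling *)

Section LaminarLabelling.
Variables (s : seq nat) (r c p : nat -> nat) (n : nat).
Hypotheses (us : uniq s) (lam : laminar s r c).
Hypothesis rc : forall k, k < size s -> r k <= c k < n.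
Hypothesis hp : forall j, j < n -> [/\ p j < size s, r (p j) = j & c (p j) = j].
Hypothesis p_first : forall j k, j < n -> k < size s -> k <> p j ->
  r k = j -> c k = j -> p j < k /\ nth 0 s (p j) < nth 0 s k.

(** The interval of [p j] is the single point [j]. Laminarity leaves the interval of [k] to lie
    before [j], after [j] or around it, and each case fixes both comparisons; when the labels agree,
    [p_first] decides. *)
Lemma labelling_pos_val j k : j < n -> k < size s ->
  (p j <= k) = (j <= c k) /\ (nth 0 s k < nth 0 s (p j)) = (j < r k).
Proof.
move=> hj hk; have [hpj rp cp] := hp hj; have rck := rc hk.
have ne : k <> p j -> nth 0 s k <> nth 0 s (p j).
  by move=> ne /eqP; rewrite nth_uniq // => /eqP.
have first := p_first hj hk.
case: (ltngtP k (p j)) => [lt|gt|e]; last by rewrite e ltnn rp cp leqnn ltnn.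
- by have := lam lt hpj; rewrite rp cp => -[[? ?]|[? ?]|[? ? ?]]; lia.
- by have := lam gt hk; rewrite rp cp => -[[? ?]|[? ?]|[? ? ?]]; lia.
Qed.

Lemma is_lrmin_labelling k : k < size s -> is_lrmin s k = (k == p (c k)).
Proof.
move=> hk; have /andP[rck hc] := rc hk; have [hpk rpk cpk] := hp hc.
have [h1 h2] := labelling_pos_val hc hk; rewrite leqnn in h1.
rewrite (ltnNge (c k)) rck /= in h2; apply/(is_lrminP hk)/eqP => [km|e i ik].
  apply/eqP; rewrite eq_sym eqn_leq h1 leqNgt; apply/negP => /km.
  by rewrite h2.
have hi := ltn_trans ik hk; have := labelling_pos_val hc hi; rewrite -e.
have : nth 0 s i <> nth 0 s k by move=> /eqP; rewrite nth_uniq // => /eqP; lia.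
by have := rc hi; lia.
Qed.

Lemma lrmins_labelling : lrmins s = map p (iota 0 n).
Proof.
apply: (irr_sorted_eq ltn_trans ltnn (lrmins_sorted s)).
  rewrite (sorted_pairwise ltn_trans) pairwise_map.
  have := iota_ltn_sorted 0 n; rewrite (sorted_pairwise ltn_trans).
  apply: (@sub_in_pairwise _ (gtn n)); last by apply/allP => k; rewrite mem_iota.
  move=> i j hi hj /= ij; have [hpi _ ci] := hp hi.
  by have [] := labelling_pos_val hj hpi; rewrite ci; lia.
move=> k; rewrite mem_lrmins; apply/andP/mapP => [[hk]|[j]].
  rewrite is_lrmin_labelling // => /eqP ek; exists (c k) => //.
  by rewrite mem_iota; have := rc hk; lia.
rewrite mem_iota add0n /= => hj ->; have [hpj rp cp] := hp hj.
by rewrite is_lrmin_labelling // cp.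
Qed.

Lemma label_labelling k : k < size s -> rowof s k = r k /\ colof s k = c k.
Proof.
move=> hk; have hn : size (lrmins s) = n by rewrite lrmins_labelling size_map size_iota.
have pE j : j < n -> lrmin_pos s j = p j.
  by move=> hj; rewrite /lrmin_pos lrmins_labelling (nth_map 0) ?size_iota // nth_iota.
have hr := rowof_ltn hk; have hc := colof_ltn hk; rewrite hn in hr hc.
have /andP[rck hck] := rc hk.
have col j : j < n -> (j <= colof s k) = (j <= c k).
  move=> hj; rewrite -lrmin_pos_leq ?hn // pE //.
  by have [] := labelling_pos_val hj hk.
have row j : j < n -> (j < rowof s k) = (j < r k).
  move=> hj; rewrite -ltn_lrmin_val_row ?hn // /lrmin_val pE //.
  by have [] := labelling_pos_val hj hk.
have := col _ hc; have := col _ hck; have := row _ hr.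
have := row (r k) (leq_ltn_trans rck hck); rewrite !leqnn !ltnn => *; lia.
Qed.

End LaminarLabelling.

(** * Assembling a word from an independent filling *)

Lemma lexi_ltn a b v w M : v < M -> w < M ->
  (a * M + v < b * M + w) = (a < b) || (a == b) && (v < w).
Proof.
move=> hv hw; case: (ltngtP a b) => [ab|ba|->] /=.
- by apply: leq_trans (leq_addr _ _); apply: leq_trans (_ : a.+1 * M <= _);
    rewrite ?leq_mul2r ?ab ?orbT // mulSn addnC ltn_add2r.
- apply/negbTE; rewrite -leqNgt; apply: ltnW; apply: leq_trans (leq_addr _ _).
  by apply: leq_trans (_ : b.+1 * M <= _);
    rewrite ?leq_mul2r ?ba ?orbT // mulSn addnC ltn_add2r.
- by rewrite ltn_add2l.
Qed.

Section PairsDep.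
Variables (T : eqType) (g : T -> seq nat).

Lemma pairwise_pairs (e : rel (T * nat)) cs :
  (forall c, pairwise (fun v w => e (c, v) (c, w)) (g c)) ->
  pairwise (fun c d => allrel (fun v w => e (c, v) (d, w)) (g c) (g d)) cs ->
  pairwise e [seq (c, v) | c <- cs, v <- g c].
Proof.
move=> hg; elim: cs => [|c cs IH] //=; rewrite pairwise_cat.
case/andP=> /allP hc /IH->; rewrite andbT pairwise_map hg andbT.
apply/allrelP => _ _ /mapP[v vg ->] /allpairsPdep[d [w [dcs wg ->]]].
by have /allrelP := hc d dcs; apply.
Qed.

Lemma filter_pairs cs c : uniq cs ->
  [seq x <- [seq (d, v) | d <- cs, v <- g d] | x.1 == c] =
  if c \in cs then [seq (c, v) | v <- g c] else [::].
Proof.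
elim: cs => [|d cs IH] //= /andP[dcs ucs]; rewrite filter_cat IH // inE.
rewrite filter_map (eq_filter (a2 := fun=> d == c)) // [c == d]eq_sym.
case: (eqVneq d c) dcs => [->|ne] dcs /=; last by rewrite filter_pred0.
by rewrite filter_predT (negbTE dcs) cats0.
Qed.

End PairsDep.

Definition pair_of n (c : cell n) : nat * nat := (nat_of_ord (row c), nat_of_ord (col c)).

Lemma pair_of_inj n : injective (@pair_of n).
Proof.
move=> c d [er ec]; apply/val_inj; rewrite (surjective_pairing (val c)).
by rewrite (surjective_pairing (val d)); congr (_, _); apply/val_inj.
Qed.

Section Inverse.
Variables (n : nat) (f : filling n) (x0 : cell n * nat).
Hypothesis f_perm : forall c, is_perm (f c).
Hypothesis f_indep : forall c d, f c <> [::] -> f d <> [::] -> ~~ down_core c d.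

(* The local value 0 stands for the left-to-right minimum of a diagonal cell. *)
Definition extended_cell (c : cell n) : seq nat :=
  if row c == col c then 0 :: f c else f c.

Definition cells : seq (cell n) :=
  sort (relpre (@pair_of n) pos_le) (enum {: cell n}).

(** The points are listed from left to right, so an index in this list is a position of the word;
    [height] supplies the vertical order. *)
Definition points : seq (cell n * nat) :=
  [seq (c, v) | c <- cells, v <- extended_cell c].

(* Rows are numbered from top to bottom, hence [n - row]. *)
Definition cell_height (c : cell n) : nat := (n - row c) * n + col c.

Lemma ltn_cell_height c d : (cell_height c < cell_height d) =
  (row d < row c) || (row d == row c) && (col c < col d).
Proof.
rewrite /cell_height lexi_ltn // -val_eqE /=.
have hc := ltn_ord (row c); have hd := ltn_ord (row d).
have -> : (n - row c < n - row d) = (row d < row c) by lia.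
by have -> : (n - row c == n - row d) = (row d == row c :> nat) by lia.
Qed.

Lemma cell_height_inj : injective cell_height.
Proof.
move=> c d e; have := ltn_cell_height c d; have := ltn_cell_height d c.
rewrite e ltnn -!val_eqE /= => h1 h2; apply: pair_of_inj.
by rewrite /pair_of; congr (_, _); lia.
Qed.

(** A strict bound on all local values; as a base it makes [height] compare cells first and local
    values second. *)
Definition point_bound := (\max_(c : cell n) \max_(v <- f c) v).+1.

Definition height (x : cell n * nat) : nat :=
  cell_height x.1 * point_bound + x.2.

Definition staircase_word : seq nat := std (map height points).

Local Notation pt k := (nth x0 points k).
Local Notation s := staircase_word.

Lemma mem_points (x : cell n * nat) : (x \in points) = (x.2 \in extended_cell x.1).
Proof.
apply/allpairsPdep/idP => [[c [v [_ vg ->]]]//|h].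
by exists x.1, x.2; split=> //; [rewrite mem_sort mem_enum | case: x {h}].
Qed.

Lemma f_gt0 c v : v \in f c -> 0 < v.
Proof. exact: mem_perm_gt0. Qed.

Lemma points_ltn (x : cell n * nat) : x \in points -> x.2 < point_bound.
Proof.
rewrite mem_points /extended_cell ltnS => h.
have : x.2 = 0 \/ x.2 \in f x.1.
  by move: h; case: ifP => _; [rewrite inE => /orP[/eqP|]; [left | right] | right].
case=> [->//|hv]; apply: leq_trans (leq_bigmax x.1).
by rewrite (big_rem x.2) //= leq_maxl.
Qed.

Lemma points_eq0 (x : cell n * nat) : x \in points -> x.2 = 0 -> row x.1 = col x.1.
Proof.
by rewrite mem_points /extended_cell; case: eqP => // _ /f_gt0; case: (x.2).
Qed.

Lemma cells_uniq : uniq cells.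
Proof. by rewrite sort_uniq enum_uniq. Qed.

Lemma points_uniq : uniq points.
Proof.
apply: allpairs_uniq_dep cells_uniq _ _ => [c _|[c v] [d w] _ _ /= [-> ->]//].
rewrite /extended_cell; case: ifP => _; rewrite /= ?is_perm_uniq // andbT.
by apply/negP => /f_gt0.
Qed.

(** The second conjunct records that the local value 0 can only come first within its cell. *)
Lemma points_sorted :
  pairwise (fun x y => pos_le (pair_of x.1) (pair_of y.1) && ((x.1 == y.1) ==> (0 < y.2)))
    points.
Proof.
apply: pairwise_pairs => [c|].
  have gt0 x l : all (ltn 0) l -> all (fun w => pos_le (pair_of c) (pair_of c) &&
      ((c == c) ==> (0 < w))) l /\ pairwise (fun v w => pos_le (pair_of c) (pair_of c) &&
      ((c == c) ==> (0 < w))) (x :: l).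
    have e : pos_le (pair_of c) (pair_of c) by rewrite /pos_le /= eqxx leqnn orbT.
    elim: l x => [|y l IH] x //= /andP[y0 /IH h].
    rewrite e eqxx y0 /=; have [h1 h2] := h y; move: h1 h2.
    by rewrite /= e eqxx /= => ->.
  have f0 : all (ltn 0) (f c) by apply/allP => v /f_gt0.
  rewrite /extended_cell; case: ifP => _; first by have [] := gt0 0 _ f0.
  by have [_] := gt0 0 _ f0; rewrite pairwise_cons => /andP[].
have : sorted (relpre (@pair_of n) pos_le) cells.
  by apply: sort_sorted => c d; apply: pos_le_total.
rewrite (sorted_pairwise (fun _ _ _ => @pos_le_trans _ _ _)) => h.
have := cells_uniq; rewrite uniq_pairwise => u.
have : pairwise (fun c d => pos_le (pair_of c) (pair_of d) && (c != d)) cells.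
  have := pairwise_relI (relpre (@pair_of n) pos_le) (fun c d => c != d) cells.
  by rewrite h u => /= ->.
apply: sub_pairwise => c d /andP[cd ne]; apply/allrelP => v w _ _ /=.
by rewrite cd (negbTE ne).
Qed.

Lemma ltn_height (x y : cell n * nat) : x \in points -> y \in points ->
  (height x < height y) =
  if x.1 == y.1 then x.2 < y.2
  else (row y.1 < row x.1) || (row y.1 == row x.1) && (col x.1 < col y.1).
Proof.
move=> hx hy; rewrite /height lexi_ltn ?points_ltn // ltn_cell_height.
case: (eqVneq x.1 y.1) => [->|ne]; first by rewrite !ltnn !eqxx andbF.
by rewrite (inj_eq cell_height_inj) (negbTE ne) orbF.
Qed.

Lemma height_inj : {in points &, injective height}.
Proof.
move=> [c v] [d w] hx hy e; have := ltn_height hx hy; have := ltn_height hy hx.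
rewrite e ltnn /= -!ltn_cell_height eq_sym.
case: (eqVneq c d) => [->|/eqP ne] h1 h2; first by congr (_, _); lia.
by case: ne; apply: cell_height_inj; lia.
Qed.

Lemma size_word : size s = size points.
Proof. by rewrite size_std size_map. Qed.

Lemma word_is_perm : is_perm s.
Proof.
apply: is_perm_std; rewrite map_inj_in_uniq ?points_uniq //; exact: height_inj.
Qed.

Lemma ltn_word i j : i < size s -> j < size s ->
  (nth 0 s i < nth 0 s j) = (height (pt i) < height (pt j)).
Proof.
rewrite size_word => hi hj; have [_ h] := same_order_std (map height points).
by rewrite -h ?size_map // !(nth_map x0).
Qed.

Lemma pt_mem k : k < size s -> pt k \in points.
Proof. by rewrite size_word; apply: mem_nth. Qed.

Lemma pt_sorted i j : i < j -> j < size s ->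
  pos_le (pair_of (pt i).1) (pair_of (pt j).1) /\
  ((pt i).1 = (pt j).1 -> 0 < (pt j).2).
Proof.
rewrite size_word => ij hj; have /(pairwiseP x0) h := points_sorted.
have /andP[h1 /implyP h2] := h i j (ltn_trans ij hj) hj ij.
by split=> // /eqP.
Qed.

(** If neither cell is diagonal, both are occupied in [f] and independence applies. A diagonal cell
    may hold only its minimum, but its interval is a point and the two inequalities suffice. *)
Lemma points_disjoint (x y : cell n * nat) : x \in points -> y \in points ->
  row x.1 < row y.1 -> col x.1 < col y.1 -> col x.1 < row y.1.
Proof.
rewrite !mem_points /extended_cell => hx hy hr hc.
case: eqP hx => [<-//|_ hx]; case: eqP hy => [->//|_ hy].
have fx : f x.1 <> [::] by move=> e; rewrite e in hx.
have fy : f y.1 <> [::] by move=> e; rewrite e in hy.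
have := f_indep fx fy; rewrite /down_core negb_or down_edgeE hr hc /=.
by rewrite -ltnNge => /andP[].
Qed.

(** Points of distinct cells are ordered horizontally by [pos_le] and vertically by [cell_height]. A
    descent makes both row and column increase, which independence turns into disjointness; an
    ascent nests the intervals. *)
Lemma word_laminar : laminar s (fun k => row (pt k).1) (fun k => col (pt k).1).
Proof.
move=> i j ij hj; have hi := ltn_trans ij hj.
have [le _] := pt_sorted ij hj; have hx := pt_mem hi; have hy := pt_mem hj.
case: (eqVneq (pt i).1 (pt j).1) => [->|ne]; first by constructor 1.
have ne' : (row (pt i).1 : nat) <> row (pt j).1 \/ (col (pt i).1 : nat) <> col (pt j).1.
  case: (eqVneq (row (pt i).1 : nat) (row (pt j).1)) => [e|/eqP]; last by left.
  by right=> e'; case/eqP: ne; apply: pair_of_inj; rewrite /pair_of e e'.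
have disj := points_disjoint hx hy.
have lt1 : (nth 0 s i < nth 0 s j) =
    (row (pt j).1 < row (pt i).1) ||
    (row (pt j).1 == row (pt i).1) && (col (pt i).1 < col (pt j).1).
  by rewrite ltn_word // ltn_height // (negbTE ne).
have lt2 : (nth 0 s j < nth 0 s i) =
    (row (pt i).1 < row (pt j).1) ||
    (row (pt i).1 == row (pt j).1) && (col (pt j).1 < col (pt i).1).
  by rewrite ltn_word // ltn_height // eq_sym (negbTE ne).
move: le lt1 lt2; rewrite -!val_eqE /pos_le /= => le lt1 lt2.
case: (boolP (nth 0 s j < nth 0 s i)) => desc.
  by constructor 2; split=> //; apply: disj; lia.
by constructor 3; split; lia.
Qed.

(** Testing the column is enough to locate diagonal cell [j], because only diagonal cells hold the
    local value 0. *)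
Definition min_index j := find (fun x => (col x.1 == j :> nat) && (x.2 == 0)) points.

Lemma min_indexP j : j < n ->
  [/\ min_index j < size s, row (pt (min_index j)).1 = j :> nat,
      col (pt (min_index j)).1 = j :> nat & (pt (min_index j)).2 = 0].
Proof.
move=> hj; have [c [rc cc]] := @exists_cell n j j (leqnn j) hj.
have h : has (fun x : cell n * nat => (col x.1 == j :> nat) && (x.2 == 0)) points.
  apply/hasP; exists (c, 0); last by rewrite /= cc !eqxx.
  by rewrite mem_points /extended_cell -val_eqE /= rc cc eqxx mem_head.
have lt : min_index j < size s by rewrite size_word -has_find.
have /andP[/eqP e /eqP e0] := nth_find x0 h; rewrite -/(min_index j) in e e0.
by split=> //; rewrite (points_eq0 (pt_mem lt) e0).
Qed.

Lemma min_index_unique j k : j < n -> k < size s -> (pt k).2 = 0 ->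
  col (pt k).1 = j :> nat -> k = min_index j.
Proof.
move=> hj hk k0 ck; have [lt rm cm m0] := min_indexP hj.
have rk := points_eq0 (pt_mem hk) k0.
apply/eqP; rewrite -(nth_uniq x0 _ _ points_uniq) -?size_word //; apply/eqP.
rewrite (surjective_pairing (pt k)) k0 (surjective_pairing (pt (min_index j))) m0.
by congr (_, _); apply: pair_of_inj; rewrite /pair_of rk ck rm cm.
Qed.

Lemma min_index_first j k : j < n -> k < size s -> k <> min_index j ->
  row (pt k).1 = j :> nat -> col (pt k).1 = j :> nat ->
  min_index j < k /\ nth 0 s (min_index j) < nth 0 s k.
Proof.
move=> hj hk ne rk ck; have [lt rm cm m0] := min_indexP hj.
have e : (pt (min_index j)).1 = (pt k).1.
  by apply: pair_of_inj; rewrite /pair_of rk ck rm cm.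
have k0 : 0 < (pt k).2.
  by rewrite lt0n; apply/eqP => k0; apply: ne; apply: min_index_unique.
split; last by rewrite ltn_word // ltn_height ?pt_mem // e eqxx m0.
rewrite ltnNge; apply/negP => le.
have lt' : k < min_index j by lia.
by have [_ /(_ (esym e))] := pt_sorted lt' lt; rewrite m0.
Qed.

Lemma word_range k : k < size s -> row (pt k).1 <= col (pt k).1 < n.
Proof. by rewrite (valP (pt k).1 : row _ <= col _) ltn_ord. Qed.

Lemma min_index_label j : j < n ->
  [/\ min_index j < size s, row (pt (min_index j)).1 = j :> nat
    & col (pt (min_index j)).1 = j :> nat].
Proof. by case/min_indexP. Qed.

Lemma word_label k : k < size s ->
  rowof s k = row (pt k).1 /\ colof s k = col (pt k).1.
Proof.
exact: (label_labelling (is_perm_uniq word_is_perm) word_laminar word_range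
          min_index_label min_index_first).
Qed.

Lemma size_lrmins_word : size (lrmins s) = n.
Proof.
rewrite (lrmins_labelling (is_perm_uniq word_is_perm) word_laminar word_range
  min_index_label min_index_first).
by rewrite size_map size_iota.
Qed.

Lemma is_lrmin_word k : k < size s -> is_lrmin s k = ((pt k).2 == 0).
Proof.
move=> hk; rewrite (is_lrmin_labelling (is_perm_uniq word_is_perm) word_laminar
  word_range min_index_label min_index_first) //.
have hc := ltn_ord (col (pt k).1); have [_ _ _ m0] := min_indexP hc.
apply/eqP/eqP => [e|k0]; first by rewrite e.
exact: min_index_unique.
Qed.

Lemma word_laminar_label : laminar s (rowof s) (colof s).
Proof.
move=> i j ij hj; have hi := ltn_trans ij hj.
have [-> ->] := word_label hi; have [-> ->] := word_label hj.
exact: word_laminar.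
Qed.

Lemma SE_word : SE n s = f.
Proof.
apply/ffunP => c; rewrite ffunE.
pose Q (x : cell n * nat) := (x.1 == c) && (0 < x.2).
have cellE k : k < size s -> in_cell s c k = Q (pt k).
  move=> hk; rewrite in_cellE ?size_lrmins_word ?(is_perm_uniq word_is_perm) //.
  rewrite is_lrmin_word // /Q lt0n andbC; congr (_ && _).
  have [-> ->] := word_label hk.
  apply/andP/eqP => [[/eqP er /eqP ec]|->]; last by rewrite !eqxx.
  by apply: pair_of_inj; rewrite /pair_of er ec.
set K := filter _ _.
have KE : K = [seq k <- iota 0 (size points) | preim (nth x0 points) Q k].
  by rewrite /K size_word; apply/eq_in_filter => k; rewrite mem_iota -size_word => /cellE.
(* Reading the non-minimum points of cell [c] from left to right returns the letters of [f c] in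
   their order; within one cell heights compare as local values. *)
have ptsE : map (nth x0 points) K = [seq (c, v) | v <- f c].
  rewrite KE -filter_map map_nth_iota_size.
  have -> : filter Q points = [seq x <- [seq x <- points | x.1 == c] | 0 < x.2].
    by rewrite -filter_predI; apply: eq_filter => x; rewrite /Q /= andbC.
  rewrite filter_pairs ?cells_uniq // mem_sort mem_enum /= filter_map; congr map.
  have fE : [seq v <- f c | 0 < v] = f c.
    by rewrite -[RHS]filter_predT; apply: eq_in_filter => v /f_gt0->.
  by rewrite /extended_cell; case: ifP => _; exact: fE.
have -> : std (map (nth 0 s) K) = std (map (fun k => (pt k).2) K).
  apply: eq_std; apply: same_order_map => i j.
  rewrite !mem_filter !mem_iota /= => /andP[ci hi] /andP[cj hj].
  move: ci cj; rewrite !cellE // => /andP[/eqP ei _] /andP[/eqP ej _].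
  by rewrite ltn_word // ltn_height ?pt_mem // ei ej eqxx.
have -> : map (fun k => (pt k).2) K = f c.
  by rewrite (map_comp snd) ptsE -map_comp map_id.
exact: std_perm.
Qed.

End Inverse.

(** * The bijection *)

Lemma contains_nil p : contains [::] p -> p = [::].
Proof. by case=> t; rewrite subseq0 => /eqP-> [/esym/size0nil]. Qed.

Lemma Avn_laminar n Q s :
  Avn n ([set [:: 2; 4; 1; 3]; [:: 3; 1; 4; 2]] `|` Q)%classic s ->
  laminar s (rowof s) (colof s).
Proof.
move=> [[/is_perm_uniq us no] _]; apply: laminar_label => //.
- by apply: no; left; left.
- by apply: no; left; right.
Qed.

Local Open Scope classical_set_scope.

Theorem theorem4p5 (P : set (seq nat))
  (hP : forall p, P p -> [/\ is_perm p, p <> [::] & sum_indecomposable p])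
  (n : nat) :
  set_bij
    (Avn n ([set [:: 2; 4; 1; 3]; [:: 3; 1; 4; 2]] `|`
            [set osum [:: 1] p | p in P]))
    (WI (@down_core n)
        (Avp ([set [:: 2; 4; 1; 3]; [:: 3; 1; 4; 2]] `|` P)))
    (@SE n).
Proof.
split.
- move=> s hs; have lam := Avn_laminar hs.
  have [[ps no] hn] := hs; have us := is_perm_uniq ps.
  split=> [c d|c c0]; first exact: SE_independent.
  split=> //; split.
    by rewrite ffunE is_perm_std // map_inj_in_uniq ?filter_uniq ?iota_uniq //
      => i j; rewrite !mem_filter !mem_iota => /andP[_ hi] /andP[_ hj] /eqP;
      rewrite nth_uniq // => /eqP.
  have sub p : contains (SE n s c) p -> contains s p.
    by rewrite ffunE => /contains_std_filter[I oI _]; apply/containsP; exists I.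
  move=> p [p4|Pp]; first by move=> /sub; apply: no; left.
  have [pp _ _] := hP p Pp; move=> /(contains_SE us hn pp).
  by apply: no; right; exists p.
- move=> s t /set_mem hs /set_mem ht e.
  have ls := Avn_laminar hs; have lt := Avn_laminar ht.
  have [[ps _] hns] := hs; have [[pt _] hnt] := ht.
  apply: perm_same_order => //.
  by apply: (SE_same_order _ _ hns hnt ls lt e); apply: is_perm_uniq.
move=> f [f_indep f_av].
have f_perm c : is_perm (f c).
  (* Membership in [WI] constrains non-empty cells only, but the empty word is a permutation as
     well. *)
  by case: (pselect (f c = [::])) => [->|/f_av[[]]].
(* A laminar word with encoding [f] avoids all the patterns, as an occurrence would reappear in a
   single cell of [f]. It remains to produce such a word. *)
have avoid s : is_perm s -> size (lrmins s) = n ->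
    laminar s (rowof s) (colof s) -> SE n s = f ->
    Avn n ([set [:: 2; 4; 1; 3]; [:: 3; 1; 4; 2]] `|` [set osum [:: 1] p | p in P]) s.
  move=> ps hn lam e; have us := is_perm_uniq ps; split=> //; split=> //.
  have no p c : ([set [:: 2; 4; 1; 3]; [:: 3; 1; 4; 2]] `|` P) p ->
      p <> [::] -> ~ contains (SE n s c) p.
    move=> Qp p0; rewrite e => h; have c0 : f c <> [::].
      by move=> fc; apply: p0; apply: contains_nil; rewrite -fc.
    by have [[_ /(_ p Qp)]] := f_av c c0.
  move=> q [[->|->]|[p Pp <-]].
  - move=> /(contains_SE_2413 us hn lam)[c]; apply: no => //; by left; left.
  - move=> /(contains_SE_3142 us hn lam)[c]; apply: no => //; by left; right.
  - have [pp p0 ind] := hP p Pp.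
    by move=> /(contains_SE_osum us hn lam pp p0 ind)[c]; apply: no => //; right.
(* The construction uses a default point, which needs a cell. For [n = 0] there is none, and the
   empty word encodes to the only filling. *)
case: n f f_indep f_av f_perm avoid => [|m] f f_indep f_av f_perm avoid.
  exists [::]; last by apply/ffunP => -[[[]]].
  by apply: avoid => //; apply/ffunP => -[[[]]].
have [c0 _] := @exists_cell m.+1 0 0 (leqnn 0) (ltn0Sn m).
exists (staircase_word f); last exact: (SE_word (c0, 0)).
apply: avoid.
- exact: word_is_perm.
- exact: (size_lrmins_word (c0, 0)).
- exact: (word_laminar_label (c0, 0)).
- exact: (SE_word (c0, 0)).
Qed.
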